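(* Let $G$ be a finitely generated group, let $K$ be a finite field, and let $X \subset A^G$ be a Lie algebraic $G$-subshift over $K$ (an internal Lie algebra over $K$ in the category of $G$-subshifts). Let $\Delta_X$ be the group of homoclinic points of $(X,+)$. If $X = \overline{\Delta_X}$ and $\Delta_X$ is finitely orbit-generated as a subgroup of $(X,+)$, then $X$ is cellwiseable, i.e. the Lie algebra operations of $X$ can be recoded to be cellwise.
   Context: Let $G$ be a group and $A$ a finite alphabet. The full shift $A^G$ has the product topology and the left shift action $(gx)_h = x_{g^{-1}h}$. A $G$-subshift is a closed $G$-invariant subset $X \subset A^G$. A block code $f : X \to Y$ between $G$-subshifts $X \subset A^G$, $Y \subset B^G$ is a continuous $G$-equivariant map; equivalently, there are a finite set $N \subset G$ (a neighborhood of $f$) and a local function $F : A^N \to B$ with $f(x)_g = F((g^{-1}x)|_N)$. Finite powers $X^n$ are regarded as subshifts of $(A^n)^G$, so $n$-ary block codes $X^n \to X$ make sense (for $n = 0$, a $G$-invariant element of $X$). A topological conjugacy is a bijective block code. A Lie algebraic $G$-subshift over a finite field $K$ is a $G$-subshift $X$ equipped with block codes for the zero element $0$ (nullary), scalar multiplication $x \mapsto ax$ for each $a \in K$, addition $(x,y) \mapsto x+y$ and a bracket $(x,y) \mapsto [x,y]$, which make $X$ a Lie algebra over $K$ (the bracket is bilinear, satisfies $[x,x]=0$ and the Jacobi identity). It is cellwise if each of these operations admits $\{1_G\}$ as a neighborhood. It is cellwiseable if there is a cellwise Lie algebraic $G$-subshift $Y$ over $K$ and a topological conjugacy $\phi :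 X \to Y$ that is also an isomorphism of Lie algebras over $K$. A point $x \in X$ is homoclinic if $gx \to 0$ as $g$ escapes finite subsets of $G$; $\Delta_X$ is the (shift-invariant) subgroup of all homoclinic points and $\overline{\Delta_X}$ is its closure. $\Delta_X$ is finitely orbit-generated if there is a finite set $Y$ such that $\Delta_X$ is generated, algebraically as a discrete group, by $\{gy : g \in G,\ y \in Y\}$. *)

(* Defs.v *)
From HB Require Import structures.
From mathcomp Require Import all_boot all_algebra.
From mathcomp Require Import all_classical topology.

Set Implicit Arguments.
Unset Strict Implicit.
Unset Printing Implicit Defensive.

Import GRing.Theory.

Local Open Scope classical_set_scope.
Local Open Scope ring_scope.

HB.mixin Record Lmodule_isLieAlgebra (K : fieldType) L & GRing.Lmodule K L := {
  lie : L -> L -> L;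
  lie_linearl : forall y : L, linear (lie^~ y);
  lie_linearr : forall x : L, linear (lie x);
  liexx : forall x : L, lie x x = 0;
  lie_jacobi : forall x y z : L,
    lie x (lie y z) + lie y (lie z x) + lie z (lie x y) = 0
}.

#[short(type="lieAlgType")]
HB.structure Definition LieAlgebra (K : fieldType) :=
  {L of Lmodule_isLieAlgebra K L & GRing.Lmodule K L}.

Section Group.
Variable G : groupType.

Definition subgroup_generated (S : set G) : set G :=
  smallest (fun H : set G => group_closed [in H]) S.

Definition finitely_generated : Prop :=
  exists2 S : set G, finite_set S & subgroup_generated S = setT.

(* Limits along this filter are limits "as g escapes finite subsets of G". If G
   is finite it is the improper filter, and all such limits hold trivially. *)
Definition escape : set_system G := [set P : set G | cofinite_set P].

End Group.
Arguments finitely_generated : clear implicits.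
Arguments escape : clear implicits.

Section Subshift.
Variable G : groupType.

Definition fullShift (A : finType) : Type := {ptws G -> discrete_topology A}.

Definition shift (A : finType) (g : G) (x : fullShift A) : fullShift A :=
  fun h => x (g^-1 * h)%g.

Record subshift (A : finType) := Subshift {
  subshift_set :> set (fullShift A);
  subshift_closed : closed subshift_set;
  subshift_invariant : forall g x, subshift_set x -> subshift_set (shift g x)
}.

Lemma shift_mem (A : finType) (X : subshift A) (g : G) (x : X) :
  shift g (val x) \in (X : set _).
Proof. by apply/mem_set/subshift_invariant/set_mem; case: x. Qed.

Definition act (A : finType) (X : subshift A) (g : G) (x : X) : X :=
  exist _ (shift g (val x)) (shift_mem g x).

Definition block_code (A B : finType) (X : subshift A) (Y : subshift B)
    (f : X -> Y) : Prop :=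
  continuous f /\ forall g x, f (act g x) = act g (f x).

Definition conjugacy (A B : finType) (X : subshift A) (Y : subshift B)
    (f : X -> Y) : Prop :=
  block_code f /\ bijective f.

(* The local function F reads the restriction to N of g^-1 x. *)
Definition has_neighborhood (A B : finType) (X : subshift A) (Y : subshift B)
    (f : X -> Y) (N : set G) : Prop :=
  exists F : (N -> A) -> B,
    forall (x : X) (g : G),
      val (f x) g = F (fun n : N => shift g^-1%g (val x) (val n)).

(* The power X^n as a subshift over the alphabet A^n; for n = 0 the alphabet is a
   singleton and X^0 is a single point. *)
Section Power.
Variables (A : finType) (X : subshift A) (n : nat).

Definition track (i : 'I_n) (p : fullShift {ffun 'I_n -> A}) : fullShift A :=
  fun g => p g i.

Definition power_set : set (fullShift {ffun 'I_n -> A}) :=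
  [set p | forall i, (X : set _) (track i p)].

Lemma track_continuous i : continuous (track i).
Proof.
move=> p; have ? : Filter (track i q @[q --> p]).
  exact/fmap_filter/nbhs_filter.
apply/cvg_sup => g U [_ [[V _ <-] /= Vpg] VU].
have /(_ [set a | V (a i)]) :=
  @proj_continuous _ (fun _ : G => discrete_topology {ffun 'I_n -> A}) g p.
rewrite nbhs_principalE => H.
have : nbhs p (proj g @^-1` [set a | V (a i)]).
  by apply: H; exact/principal_filterP.
by apply: filterS => q /= Vq; exact: VU.
Qed.

Lemma power_closed : closed power_set.
Proof.
have -> : power_set = \bigcap_i (track i @^-1` X).
  by apply/seteqP; split=> p /= Xp i; [move=> _|]; exact: Xp.
apply: closed_bigI => i _; apply: preimage_closed (@subshift_closed _ X) => p _.
exact: track_continuous.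
Qed.

Lemma power_invariant g p : power_set p -> power_set (shift g p).
Proof. by move=> Xp i; exact: (subshift_invariant g (Xp i)). Qed.

Definition power : subshift {ffun 'I_n -> A} :=
  Subshift power_closed power_invariant.

Lemma track_mem (p : power) (i : 'I_n) : track i (val p) \in (X : set _).
Proof. by apply/mem_set; case: p => p /= /set_mem. Qed.

(* The bijection from the points of X^n to the n-tuples of points of X. *)
Definition tracks (p : power) (i : 'I_n) : X :=
  exist _ (track i (val p)) (track_mem p i).

Definition nary_block_code (f : ('I_n -> X) -> X) : Prop :=
  block_code (fun p : power => f (tracks p)).

Definition nary_has_neighborhood (f : ('I_n -> X) -> X) (N : set G) : Prop :=
  has_neighborhood (fun p : power => f (tracks p)) N.

End Power.
End Subshift.

Section LieSubshift.
Variables (K : finFieldType) (G : groupType).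

Record lieOnSubshift (A : finType) := LieOnSubshift {
  lie_subshift :> subshift G A;
  lie_class : LieAlgebra K lie_subshift
}.

(* The set of points of X, with both the subspace topology and the Lie algebra
   structure. *)
Definition points (A : finType) (X : lieOnSubshift A) : Type := X.
HB.instance Definition _ (A : finType) (X : lieOnSubshift A) :=
  LieAlgebra.copy (points X) (LieAlgebra.Pack (lie_class X)).

(* P holds of each of the Lie algebra operations of X, viewed as n-ary maps. *)
Definition lie_operations (A : finType) (X : lieOnSubshift A)
    (P : forall n, (('I_n -> points X) -> points X) -> Prop) : Prop :=
  [/\ P 0%N (fun=> 0),
      forall a : K, P 1%N (fun v => a *: v ord0),
      P 2%N (fun v => v ord0 + v ord_max)
    & P 2%N (fun v => lie (v ord0) (v ord_max))].

Record lieSubshift (A : finType) := LieSubshift {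
  lie_on :> lieOnSubshift A;
  lie_block_codes :
    lie_operations (fun n (f : (_ -> points lie_on) -> _) =>
      @nary_block_code G A lie_on n f)
}.

Definition cellwise (A : finType) (X : lieSubshift A) : Prop :=
  lie_operations (fun n (f : (_ -> points X) -> _) =>
    @nary_has_neighborhood G A X n f [set 1%g]).

Definition cellwiseable (A : finType) (X : lieSubshift A) : Prop :=
  exists (B : finType) (Y : lieSubshift B), cellwise Y /\
    exists phi : points X -> points Y,
      [/\ @conjugacy G A B X Y phi, linear phi
        & {morph phi : x y / lie x y}].

Section Homoclinic.
Variables (A : finType) (X : lieSubshift A).

Definition homoclinic : set (points X) :=
  [set x : points X | act g x @[g --> escape G] --> (0 : points X)].

Definition orbit_generated (Y : set (points X)) : set (points X) :=
  smallest (fun D : set (points X) => zmod_closed [in D])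
    [set z | exists g, exists2 y, Y y & z = act g y].

Definition finitely_orbit_generated (D : set (points X)) : Prop :=
  exists2 Y : set (points X), finite_set Y & D = orbit_generated Y.

End Homoclinic.

End LieSubshift.
Arguments homoclinic {K G A} X _.

(* Main.v *)
Require Import Defs.
From HB Require Import structures.
From mathcomp Require Import all_boot all_algebra.
From mathcomp Require Import all_classical topology.

Set Implicit Arguments.
Unset Strict Implicit.
Unset Printing Implicit Defensive.

Import GRing.Theory.

Local Open Scope classical_set_scope.
Local Open Scope ring_scope.

(* An open ideal U contained in {x | x_1 = 0_1} makes X cellwise: the map
   x |-> (g^-1 x + U)_g is injective, its image is a subshift over the finite
   alphabet X / U, and the operations of X descend to this alphabet because U is
   an ideal. To find U, start from an open subspace U0 of {x | x_1 = 0_1} and let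
   T_n be the set of u such that every word of length at most n in the operators
   ad a, a homoclinic, maps u into U0. Each T_n is open, since for an open V and
   a homoclinic y one has [g y, X] <= V for all but finitely many g.
   The sequence T_n is stationary. By the Jacobi identity, the letters of a word
   can be permuted modulo shorter words. Take the letters among the generators
   g y_i. If one of them is far from the identity, move it to the front, where it
   maps everything into U0. Otherwise the letters come from a fixed finite set; in
   a long word some letter m is repeated, and since ad m has finite range, two of
   its powers coincide, which shortens the word.
   The limit is stable under ad a for all homoclinic a, hence, by density, it is
   an ideal. *)

(** * Words in the adjoint operators of a Lie algebra *)

(** On its finite range [f] is a self-map of a finite type, and the iterates of such a map
    repeat. *)
Lemma iter_finite_range (T : choiceType) (f : T -> T) :
  finite_set (range f) -> exists i j, (i < j)%N /\ iter j f =1 iter i f.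
Proof.
move=> /finite_seqP[E rE].
have fE x : f x \in E.
  by have : [set` E] (f x) by rewrite -rE; exists x.
pose h := [ffun t : seq_sub E => SeqSub (fE (val t))].
have hE n t : val (iter n h t) = iter n f (val t).
  by elim: n => //= n <-; rewrite ffunE.
(* Composition with [h] acts on a finite type of functions, and its orbit from the identity consists
   of the iterates of [h]. *)
pose c (k : {ffun seq_sub E -> seq_sub E}) := [ffun t => h (k t)].
have cE n t : iter n c (finfun id) t = iter n h t.
  by elim: n t => [|n IH] t /=; rewrite !ffunE ?IH.
have /trajectP[i ij ji] := looping_order c (finfun id).
(* One extra application of [f] brings an arbitrary [x] into the range. *)
exists i.+1, (order c (finfun id)).+1; split=> // x.
by rewrite !iterSr -[f x]/(val (SeqSub (fE x))) -!hE -!cE ji.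
Qed.

Section Words.
Variables (K : fieldType) (L : lieAlgType K).
Implicit Types (s p : seq L) (x y u : L) (D U : set L).

HB.instance Definition _ (x : L) :=
  GRing.isLinear.Build K L L _ (lie x) (lie_linearr x).

Lemma lieDl x y u : lie (x + y) u = lie x u + lie y u.
Proof. by have := lie_linearl u 1 x y; rewrite /= !scale1r. Qed.

Lemma lie0l u : lie 0 u = 0 :> L.
Proof. by apply: (addrI (lie 0 u)); rewrite -lieDl !addr0. Qed.

Lemma lieNl x u : lie (- x) u = - lie x u.
Proof. by apply/eqP; rewrite -addr_eq0 -lieDl addNr lie0l. Qed.

Lemma lieBl x y u : lie (x - y) u = lie x u - lie y u.
Proof. by rewrite lieDl lieNl. Qed.

Lemma lieZl (a : K) x u : lie (a *: x) u = a *: lie x u.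
Proof. by have := lie_linearl u a x 0; rewrite /= !addr0 lie0l addr0. Qed.

Lemma lieC x y : lie x y = - lie y x.
Proof.
apply/eqP; rewrite -addr_eq0; apply/eqP.
by have := liexx (x + y); rewrite lieDl !raddfD /= !liexx add0r addr0.
Qed.

Lemma lieA x y u : lie (lie x y) u = lie x (lie y u) - lie y (lie x u).
Proof.
have := lie_jacobi x y u; rewrite (lieC u (lie x y)) (lieC u x) raddfN /=.
by move/eqP; rewrite subr_eq0 => /eqP <-.
Qed.

Definition ad_word s u := foldr lie u s.

Lemma ad_word_cat s p u : ad_word (s ++ p) u = ad_word s (ad_word p u).
Proof. exact: foldr_cat. Qed.

Lemma ad_word_linear s : linear (ad_word s).
Proof. by move=> a u v; elim: s => //= x s ->; rewrite linearP. Qed.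

HB.instance Definition _ s :=
  GRing.isLinear.Build K L L _ (ad_word s) (ad_word_linear s).

Lemma ad_word_nseq n x u : ad_word (nseq n x) u = iter n (lie x) u.
Proof. by elim: n => //= n ->. Qed.

Lemma ad_word_swap p x y s u :
  ad_word (p ++ x :: y :: s) u - ad_word (p ++ y :: x :: s) u =
  ad_word (p ++ lie x y :: s) u.
Proof. by rewrite !ad_word_cat -raddfB /= lieA. Qed.

Definition letters_in D s := forall x, x \in s -> D x.

Lemma letters_in_cons D x s : letters_in D (x :: s) <-> D x /\ letters_in D s.
Proof.
split=> [Ds|[Dx Ds] y]; last by rewrite inE => /predU1P[->|/Ds].
by split=> [|y ys]; apply: Ds; rewrite inE ?eqxx ?ys ?orbT.
Qed.

Lemma letters_in_cat D p s :
  letters_in D (p ++ s) <-> letters_in D p /\ letters_in D s.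
Proof.
elim: p => [|x p IHp] /=; first by split=> [?|[]//]; split.
by rewrite !letters_in_cons IHp; tauto.
Qed.

Definition linear_subspace U := U 0 /\ forall a u v, U u -> U v -> U (a *: u + v).

Lemma linear_subspaceB U u v : linear_subspace U -> U u -> U v -> U (u - v).
Proof. by case=> _ UP Uu Uv; rewrite addrC -scaleN1r; apply: UP. Qed.

Lemma linear_subspaceD U u v : linear_subspace U -> U u -> U v -> U (u + v).
Proof. by case=> _ UP Uu Uv; rewrite -[u]scale1r; apply: UP. Qed.

(** For [D] the homoclinic points, this is T_n. *)
Definition word_core D U n : set L := [set u | forall s,
  (size s <= n)%N -> letters_in D s -> U (ad_word s u)].

Section Core.
Variables D U : set L.
Hypotheses (subU : linear_subspace U) (lieD : forall x y, D x -> D y -> D (lie x y)).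

Lemma word_core_subspace n : linear_subspace (word_core D U n).
Proof.
have [U0 UP] := subU; split=> [|a u v un vn] s sn Ds; first by rewrite linear0.
by rewrite linearP; apply: UP; [exact: un|exact: vn].
Qed.

(** The letter [x] passes the letters of [s1] one at a time. Each exchange costs a word in which the
    two letters are replaced by their bracket; it has length [n] and letters in [D], so its value
    lies in [U]. *)
Lemma ad_word_move n u p x s1 s2 : word_core D U n u ->
  size (p ++ s1 ++ x :: s2) = n.+1 -> letters_in D (p ++ s1 ++ x :: s2) ->
  U (ad_word (p ++ x :: s1 ++ s2) u) -> U (ad_word (p ++ s1 ++ x :: s2) u).
Proof.
move=> un; elim: s1 p => [//|y s1 IHs1] p.
rewrite cat_cons -cat_rcons => sz Dw Uw.
apply: IHs1 => //; rewrite cat_rcons.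
rewrite -[X in U X](subKr (ad_word (p ++ x :: (y :: s1) ++ s2) u)).
apply: linear_subspaceB => //; rewrite ad_word_swap; apply: un.
  by move: sz; rewrite !size_cat size_rcons /= size_cat !addnS addSn => -[->].
move: Dw; rewrite cat_rcons !(letters_in_cat, letters_in_cons).
by case=> Dp [Dy [Ds1 [Dx Ds2]]]; do !split=> //; exact: lieD.
Qed.

(** Selection sort: the letter that [s'] needs next moves to the front of the remaining word and
    then joins the prefix [p]. *)
Lemma ad_word_perm n u p s s' : word_core D U n u -> perm_eq s s' ->
  size (p ++ s) = n.+1 -> letters_in D (p ++ s) ->
  U (ad_word (p ++ s') u) -> U (ad_word (p ++ s) u).
Proof.
move=> un; elim: s' s p => [|x s' IHs'] s p.
  by move/perm_nilP->.
move=> /[dup] /perm_mem/(_ x); rewrite mem_head => /splitPr[s1 s2].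
rewrite -[x :: s2]cat1s perm_catCA /= perm_cons => ss' sz Dw Uw.
apply: (ad_word_move un) => //; rewrite -cat_rcons; apply: IHs' => //.
- by rewrite cat_rcons -sz !size_cat /= size_cat !addnS.
- move: Dw; rewrite cat_rcons !(letters_in_cat, letters_in_cons).
  by case=> Dp [Ds1 [Dx Ds2]].
by rewrite cat_rcons.
Qed.

(** [D_ind] expresses that [S] generates [D] as an additive group. [S] will be the set of translates
    of the generators, and [M] a finite list containing those whose brackets may leave [U]. *)
Variables (S : set L) (M : seq L) (d : nat).
Hypotheses (SD : S `<=` D).
Hypothesis D_ind : forall P : set L, P 0 ->
  (forall x y, P x -> P y -> P (x - y)) -> S `<=` P -> D `<=` P.
Hypothesis farS : forall x, S x -> x \notin M -> forall u, U (lie x u).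
Hypothesis period : forall x, S x -> x \in M ->
  exists i j, [/\ (i < j)%N, (j <= d)%N & iter j (lie x) =1 iter i (lie x)].

Lemma letters_inW s : letters_in S s -> letters_in D s.
Proof. by move=> Ss x /Ss/SD. Qed.

Lemma ad_word_generators n u s : (size M * d <= n)%N -> word_core D U n u ->
  size s = n.+1 -> letters_in S s -> U (ad_word s u).
Proof.
move=> Mn un sz Ss; have Ds := letters_inW Ss.
have [sM|] := boolP (all [in M] s); last first.
  (* A letter outside [M], once in front, maps everything into [U]. *)
  case/allPn=> x xs xM; apply: (ad_word_perm (p := [::]) un (perm_to_rem xs)) => //=.
  by apply: farS => //; exact: Ss.
(* Pigeonhole: if every letter of [M] occurred at most [d] times, the length would be at most
   [size M * d], hence at most [n]. *)
have [x xM xd] : exists2 x, x \in M & (d < count_mem x s)%N.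
  apply/hasP; apply: contraLR sM => /hasPn cM; apply/negP => sM.
  have : (size s <= size M * d)%N.
    elim: (M) s {sz Ss Ds} sM cM => [|x M' IH] s sM cM.
      by case: s sM {cM}.
    have -> : size s = (count_mem x s + size [seq y <- s | y != x])%N.
      by rewrite size_filter -(count_predC (pred1 x) s).
    rewrite mulSn leq_add //; first by rewrite leqNgt cM ?mem_head.
    apply: IH.
      apply/allP => y; rewrite mem_filter => /andP[yx /(allP sM)].
      by rewrite !inE (negPf yx).
    move=> y yM; apply: contra (cM y _) => [/leq_trans|].
      by apply; apply: leq_count_subseq; exact: filter_subseq.
    by rewrite inE yM orbT.
  by rewrite sz leqNgt ltnS Mn.
have xs : x \in s by rewrite -has_pred1 has_count (leq_ltn_trans _ xd).
have [i [j [ij jd perj]]] := period (Ss _ xs) xM.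
(* With [j] copies of [x] in front, lowering the exponent from [j] to [i] leaves a word of length at
   most [n]. *)
pose s' := nseq (count_mem x s - j) x ++ [seq y <- s | y != x].
have ss' : perm_eq s (nseq j x ++ s').
  rewrite catA -nseqD subnKC; last by rewrite (leq_trans jd) // ltnW.
  have <- : [seq y <- s | pred1 x y] = nseq (count_mem x s) x.
    by rewrite -size_filter; apply/all_pred1P/filter_all.
  by rewrite perm_sym; apply/permPl/(perm_filterC (pred1 x)).
apply: (ad_word_perm (p := [::]) un ss') => //=.
rewrite ad_word_cat ad_word_nseq perj -ad_word_nseq -ad_word_cat; apply: un.
  have := perm_size ss'; rewrite sz !size_cat !size_nseq => E.
  by rewrite -ltnS E ltn_add2r.
move=> y; rewrite mem_cat => /orP[|ys]; last first.
  by apply: Ds; rewrite (perm_mem ss') mem_cat ys orbT.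
rewrite mem_nseq => /andP[_ /eqP->]; exact: Ds.
Qed.

(** Only words of length [n.+1] are new. Their value is additive in each letter, which reduces the
    letters to generators one by one. *)
Lemma word_core_stable n : (size M * d <= n)%N ->
  word_core D U n `<=` word_core D U n.+1.
Proof.
move=> Mn u un s; rewrite leq_eqVlt ltnS => /predU1P[sz|]; last exact: un.
(* The prefix [p] collects the letters already reduced to generators. *)
suff H p : size (p ++ s) = n.+1 -> letters_in S p -> letters_in D s ->
  U (ad_word (p ++ s) u) by exact: (H [::]).
elim: s p {sz} => [|x s IHs] p.
  by rewrite cats0 => sz Sp _; exact: ad_word_generators un sz Sp.
move=> sz Sp; rewrite letters_in_cons => -[Dx Ds].
move: x Dx sz; apply: D_ind => [|x y IHx IHy|x Sx].
- by rewrite ad_word_cat /= lie0l linear0; case: subU.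
- rewrite ad_word_cat /= lieBl raddfB /= => sz; have E z := ad_word_cat p (z :: s) u.
  rewrite -[ad_word p (lie x _)]E -[ad_word p (lie y _)]E.
  by apply: linear_subspaceB => //; [apply: IHx|apply: IHy];
     move: sz; rewrite !size_cat.
rewrite -cat_rcons => sz; apply: IHs => // y.
by rewrite mem_rcons inE => /predU1P[->|/Sp].
Qed.
End Core.
End Words.

(** * Cylinders and uniform continuity *)

Section Cylinders.
Variables (G : groupType) (A : finType).
Implicit Types (x y : fullShift G A) (P : seq G).

Definition agree P x y := forall p, p \in P -> x p = y p.

Lemma agree_sym P x y : agree P x y -> agree P y x.
Proof. by move=> xy p /xy. Qed.

Lemma agree_trans P x y z : agree P x y -> agree P y z -> agree P x z.
Proof. by move=> xy yz p pP; rewrite xy ?yz. Qed.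

Lemma agree_cat P Q x y : agree (P ++ Q) x y <-> agree P x y /\ agree Q x y.
Proof.
split=> [xy|[xyP xyQ] p]; last by rewrite mem_cat => /orP[/xyP|/xyQ].
by split=> p pP; apply: xy; rewrite mem_cat pP ?orbT.
Qed.

Lemma agree_sub P Q x y : {subset P <= Q} -> agree Q x y -> agree P x y.
Proof. by move=> PQ xy p /PQ/xy. Qed.

Lemma nbhs_cylinder x (U : set (fullShift G A)) :
  nbhs x U <-> exists P, [set y | agree P x y] `<=` U.
Proof.
split.
  (* The product topology is the supremum of the topologies induced by the coordinates, so
     convergence of the cylinder filter is checked at a single coordinate. *)
  pose F : set_system (fullShift G A) :=
    [set V | exists P, [set y | agree P x y] `<=` V].
  have FF : Filter F.
    split=> [|V W [P PV] [Q QW]|V W VW [P PV]].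
    - by exists [::].
    - by exists (P ++ Q) => y /agree_cat[/PV ? /QW].
    - by exists P; exact: subset_trans VW.
  suff : F --> x by apply.
  apply/cvg_sup => g V [_ [[W _ <-] /= Wxg] WV].
  by exists [:: g] => y xy; apply: WV => /=; rewrite -(xy g) ?mem_head.
case=> P; elim: P U => [|p P IHP] U PU.
  by apply: filterS (@filterT _ _ (nbhs_filter x)) => y _; apply: PU.
have FF : Filter (nbhs x) by exact: nbhs_filter.
have : nbhs x ([set y | y p = x p] `&` [set y | agree P x y]).
  apply: filterI; last exact: IHP.
  have /(_ [set a | a = x p]) :=
    @proj_continuous _ (fun _ : G => discrete_topology A) p x.
  rewrite nbhs_principalE => H.
  have : nbhs x (proj p @^-1` [set a | a = x p]).
    by apply: H; exact/principal_filterP.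
  by [].
by apply: filterS => y /= [yx xy]; apply: PU => q; rewrite inE => /predU1P[->|/xy].
Qed.

Lemma fullShift_compact : compact [set: fullShift G A].
Proof.
have := @tychonoff G (fun=> discrete_topology A) (fun=> setT).
rewrite (_ : [set f | _] = setT); last by apply/seteqP; split.
apply=> _; apply: finite_compact; exact: finite_finset.
Qed.

Lemma fullShift_hausdorff : hausdorff_space (fullShift G A).
Proof. by apply: hausdorff_product => g; exact: discrete_hausdorff. Qed.

End Cylinders.

Section SubshiftTopology.
Variables (G : groupType) (A : finType) (X : subshift G A).
Implicit Types (x y : X) (P : seq G).

Lemma subshift_nbhs x (U : set X) :
  nbhs x U <-> exists P, [set y : X | agree P (val x) (val y)] `<=` U.
Proof.
split.
  rewrite nbhsE => -[_ [[V Vo <-] Vx] VU].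
  have /nbhs_cylinder[P PV] : nbhs (val x) V by exact: open_nbhs_nbhs.
  by exists P => y xy; apply: VU; exact: PV.
move=> [P PU].
apply: (@filterS _ _ _ (set_val @^-1` [set z | agree P (val x) z])).
  by move=> y; exact: PU.
apply: (@initial_continuous X _ set_val); apply/nbhs_cylinder.
by exists P.
Qed.

Lemma subshift_compact : compact [set: X].
Proof.
have Xc : compact (X : set (fullShift G A)).
  by apply: (subclosed_compact _ (fullShift_compact (A:=A))) => //;
     exact: subshift_closed.
move=> F FF _.
have [|z [Xz Fz]] := Xc ((val : X -> fullShift G A) @ F) (fmap_proper_filter _ FF).
  by apply: (@filterS _ F _ setT) => [x _|]; [exact: set_valP|exact: filterT].
exists (exist _ z (mem_set Xz)); split=> // C D FC.
move/subshift_nbhs=> [P PD].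
have zP : nbhs z [set y | agree P z y] by apply/nbhs_cylinder; exists P.
have CF : ((val : X -> fullShift G A) @ F) (val @` C).
  by apply: (@filterS _ F _ C) => // x Cx; exists x.
have [_ [[x Cx <-] /= xP]] := Fz _ _ CF zP.
by exists x; split=> //; apply: PD.
Qed.

End SubshiftTopology.

Section Continuity.
Variables (G : groupType) (A B : finType) (X : subshift G A).

Lemma continuous_cylinders (Y : subshift G B) (f : X -> Y) :
  (forall P, exists Q, forall x y,
    agree Q (val x) (val y) -> agree P (val (f x)) (val (f y))) ->
  continuous f.
Proof.
move=> fP x U /subshift_nbhs[P PU]; have [Q fQ] := fP P.
by apply/subshift_nbhs; exists Q => y xy; apply: PU; exact: fQ.
Qed.

(** Compactness in its near-covering form is applied with the filter of large finite windows, which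
    merges the local windows into one. *)
Lemma uniform_cylinders (Y : subshift G B) (f : X -> Y) : continuous f ->
  forall P, exists Q, forall x y,
    agree Q (val x) (val y) -> agree P (val (f x)) (val (f y)).
Proof.
move=> fc P.
pose F : set_system (seq G) :=
  [set V | exists Q0 : seq G, forall Q, {subset Q0 <= Q} -> V Q].
have FF : Filter F.
  split=> [|V W [Q QV] [R RW]|V W VW [Q QV]].
  - by exists [::].
  - exists (Q ++ R) => S QRS; split; [apply: QV|apply: RW] => g gQ; apply: QRS;
    by rewrite mem_cat gQ ?orbT.
  - by exists Q => R /QV/VW.
pose good Q (x : X) := forall y,
  agree Q (val x) (val y) -> agree P (val (f x)) (val (f y)).
have /compact_near_coveringP/(_ _ F good FF) := @subshift_compact G A X.
case=> [x _|Q QP]; last by exists Q => x y; apply: (QP Q).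
have /fc/subshift_nbhs[Q QP] : nbhs (f x) [set z : Y | agree P (val (f x)) (val z)].
  by apply/subshift_nbhs; exists P.
exists ([set y : X | agree Q (val x) (val y)], [set R | {subset Q <= R}]).
  by split; [apply/subshift_nbhs; exists Q|exists Q].
move=> [y R] /= [xy QR] z /(agree_sub QR) yz.
exact: agree_trans (agree_sym (QP _ xy)) (QP _ (agree_trans xy yz)).
Qed.
End Continuity.

(** * Lie algebraic subshifts *)

Section Shift.
Variables (G : groupType) (A : finType) (X : subshift G A).

Lemma actM g h (x : X) : act (g * h)%g x = act g (act h x).
Proof.
by apply: val_inj; apply/funext => k; rewrite /= /shift invgM mulgA.
Qed.

Lemma val_act g (x : X) h : val (act g x) h = val x (g^-1 * h)%g.
Proof. by []. Qed.

Lemma val1_act g (x : X) : val (act g^-1%g x) 1%g = val x g.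
Proof. by rewrite val_act invgK mulg1. Qed.
End Shift.

(** * Block codes on powers as maps of tuples *)

Section Bundle.
Variables (G : groupType) (A : finType) (X : subshift G A) (n : nat).

Definition bundle_fun (v : 'I_n -> X) : fullShift G {ffun 'I_n -> A} :=
  fun g => [ffun i => val (v i) g].

Lemma track_bundle_fun v i : track i (bundle_fun v) = val (v i).
Proof. by apply/funext => g; rewrite /track ffunE. Qed.

Lemma bundle_subproof v : bundle_fun v \in (power X n : set _).
Proof. by apply/mem_set => i; rewrite track_bundle_fun; exact: set_valP. Qed.

Definition bundle v : power X n := exist _ (bundle_fun v) (bundle_subproof v).

Lemma bundleK v : tracks (bundle v) = v.
Proof. by apply/funext => i; apply: val_inj; rewrite /= track_bundle_fun. Qed.

Lemma tracks_act g (p : power X n) : tracks (act g p) = fun i => act g (tracks p i).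
Proof. by apply/funext => i; apply: val_inj. Qed.

Variable f : ('I_n -> X) -> X.
Hypothesis f_block : nary_block_code f.

Lemma nary_act g v : f (fun i => act g (v i)) = act g (f v).
Proof. by have [_ /(_ g (bundle v))] := f_block; rewrite tracks_act bundleK. Qed.

Lemma nary_uniform P : exists Q : seq G, forall v w,
  (forall i, agree Q (val (v i)) (val (w i))) -> agree P (val (f v)) (val (f w)).
Proof.
have [/uniform_cylinders/(_ P)[Q QP] _] := f_block; exists Q => v w vw.
have := QP (bundle v) (bundle w); rewrite !bundleK; apply=> q qQ.
by apply/ffunP => i; rewrite !ffunE; exact: vw.
Qed.
End Bundle.

Section LieSubshift.
Variables (K : finFieldType) (G : groupType) (A : finType) (X : lieSubshift K G A).
Local Notation L := (points X).
Local Notation lact g x := (@act G A X g (x : L) : L).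
Implicit Types (x y : L) (P Q : seq G).

Definition lagree P x y := @agree G A P (val x) (val y).

Definition binary_block_code (op : L -> L -> L) : Prop :=
  @nary_block_code G A X 2 (fun v : 'I_2 -> L => op (v ord0) (v ord_max)).

Definition pair_fun (x y : L) (i : 'I_2) : L := if i == ord0 then x else y.

Lemma binary_act op g x y : binary_block_code op ->
  op (lact g x) (lact g y) = lact g (op x y).
Proof. by move=> /nary_act/(_ g (pair_fun x y)). Qed.

Lemma binary_uniform op P : binary_block_code op -> exists Q, forall x y x' y',
  lagree Q x x' -> lagree Q y y' -> lagree P (op x y) (op x' y').
Proof.
move=> /nary_uniform/(_ P)[Q QP]; exists Q => x y x' y' xx' yy'.
by apply: (QP (pair_fun x y) (pair_fun x' y')) => i; rewrite /pair_fun; case: ifP.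
Qed.

Lemma add_block : binary_block_code +%R.
Proof. by have [] := lie_block_codes X. Qed.

Lemma lie_block : binary_block_code lie.
Proof. by have [] := lie_block_codes X. Qed.

Lemma actD g x y : lact g (x + y) = lact g x + lact g y :> L.
Proof. by rewrite (binary_act _ _ _ add_block). Qed.

Lemma act_lie g x y : lact g (lie x y) = lie (lact g x) (lact g y) :> L.
Proof. by rewrite (binary_act _ _ _ lie_block). Qed.

Lemma actZ g (a : K) x : lact g (a *: x) = a *: lact g x :> L.
Proof.
have [_ /(_ a) aX _ _] := lie_block_codes X.
by have := nary_act aX g (fun=> x).
Qed.

Lemma act0 g : lact g 0 = 0 :> L.
Proof. by rewrite -{1}[0](scale0r (0 : L)) actZ scale0r. Qed.

Lemma actB g x y : lact g (x - y) = lact g x - lact g y :> L.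
Proof. by rewrite -!scaleN1r actD actZ. Qed.

Lemma scale_uniform (a : K) P : exists Q, forall x x',
  lagree Q x x' -> lagree P (a *: x) (a *: x').
Proof.
have [_ /(_ a) aX _ _] := lie_block_codes X; have [Q QP] := nary_uniform aX P.
by exists Q => x x' xx'; apply: (QP (fun=> x) (fun=> x')).
Qed.

Lemma lagree_refl P x : lagree P x x. Proof. by []. Qed.

Lemma sub_uniform P : exists Q, forall x y x' y',
  lagree Q x x' -> lagree Q y y' -> lagree P (x - y) (x' - y').
Proof.
have [Q QP] := binary_uniform P add_block; have [R RQ] := scale_uniform (-1) Q.
exists (Q ++ R) => x y x' y' /agree_cat[xQ xR] /agree_cat[yQ yR].
by rewrite -2!scaleN1r; apply: QP => //; exact: RQ.
Qed.

(* Openness is used only for subspaces, so neighborhoods of 0 suffice. *)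
Definition open_at0 (U : set L) := exists P, [set x | lagree P x 0] `<=` U.

Lemma open_at0W U V : U `<=` V -> open_at0 U -> open_at0 V.
Proof. by move=> UV [P PU]; exists P; exact: subset_trans UV. Qed.

Lemma open_at0I U V : open_at0 U -> open_at0 V -> open_at0 (U `&` V).
Proof.
by move=> [P PU] [Q QV]; exists (P ++ Q) => x /agree_cat[/PU ? /QV].
Qed.

Lemma open_at0_all (T : eqType) (s : seq T) (U : T -> set L) :
  (forall t, open_at0 (U t)) -> open_at0 [set x | forall t, t \in s -> U t x].
Proof.
move=> Uo; elim: s => [|t s IHs]; first by exists [::].
apply: open_at0W (open_at0I (Uo t) IHs) => x [Ut Us] t'.
by rewrite inE => /predU1P[->|/Us].
Qed.

Lemma open_at0_lie U x : open_at0 U -> open_at0 [set u | U (lie x u)].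
Proof.
move=> [P PU]; have [Q QP] := binary_uniform P lie_block; exists Q => u u0 /=.
by apply: PU; rewrite /= -[0](linear0 (lie x)); apply: QP.
Qed.

(** Subtraction is uniformly continuous. For a subspace [U], the coset of a point is thus determined
    by its restriction to a finite window, so the quotient is finite. *)
Lemma open_at0_cosets U : open_at0 U ->
  exists Q, forall x y, lagree Q x y -> U (x - y).
Proof.
move=> [P PU]; have [Q QP] := sub_uniform P; exists Q => x y xy.
by apply: PU; rewrite /= -(subrr y); apply: QP.
Qed.

(* The set [x 1 = 0 1] need not be a subspace; its translational stabilizer is one,
   and is contained in it. *)
Definition core_subspace : set L := [set h | forall (a : K) (v : L),
  val v 1%g = val (0 : L) 1%g -> val (v + a *: h) 1%g = val (0 : L) 1%g].

Lemma core_subspaceP : linear_subspace core_subspace.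
Proof.
split=> [|a h h']; first by move=> a v v0; rewrite scaler0 addr0.
move=> hH h'H b v v0.
by rewrite scalerDr scalerA addrA; apply: h'H; apply: hH.
Qed.

(** Adding a point near 0 does not change the cell at 1, uniformly in [v]; as [K] is finite, all
    multiples of [h] are near 0 at once. *)
Lemma core_subspace_open : open_at0 core_subspace.
Proof.
have [Q QP] := binary_uniform [:: 1%g] add_block.
have : open_at0 [set h | forall a : K, a \in enum K -> lagree Q (a *: h) 0].
  apply: open_at0_all => a; have [R RQ] := scale_uniform a Q.
  by exists R => h h0 /=; rewrite -[X in lagree Q _ X](scaler0 _ a); exact: RQ.
apply: open_at0W => h hQ a v <-.
have := QP v (a *: h) v 0 (@lagree_refl Q v) (hQ a (mem_enum _ _)).
by move/(_ 1%g (mem_head _ _)); rewrite addr0.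
Qed.

Lemma core_subspace_cell x : core_subspace x -> val x 1%g = val (0 : L) 1%g.
Proof. by move=> xC; have := xC 1 0 erefl; rewrite scale1r add0r. Qed.

Lemma eq_cell x y : (forall g, val (lact g (x - y)) 1%g = val (0 : L) 1%g) -> x = y.
Proof.
move=> xy; apply/eqP; rewrite -subr_eq0; apply/eqP/val_inj/funext => g.
have E z : val (z : L) g = val (lact g^-1%g z) 1%g := esym (val1_act g z).
by rewrite (E (x - y)) (E 0) act0.
Qed.

Lemma homoclinicP x :
  homoclinic X x <-> forall P, cofinite_set [set g : G | lagree P (lact g x) 0].
Proof.
split=> [x0 P|x0 U].
  have /x0 : nbhs (0 : L) [set y : L | lagree P y 0]; last by [].
  by apply/(@subshift_nbhs G A X (0 : L)); exists P => y /agree_sym.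
move/(@subshift_nbhs G A X (0 : L))=> [P PU]; apply: sub_finite_set (x0 P) => g.
by apply: contra_not => /agree_sym/PU.
Qed.

End LieSubshift.

(** * Open ideals from homoclinic points *)

Section Ideal.
Variables (K : finFieldType) (G : groupType) (A : finType) (X : lieSubshift K G A).
Local Notation L := (points X).
Local Notation lact g x := (@act G A X g (x : L) : L).
Implicit Types (x y u : L) (P Q : seq G) (U : set L).

(** The bracket is uniformly continuous: once the translate of [x] agrees with 0 on a large window,
    its bracket with [u] is close to that of 0 with [u], whatever [u] is. *)
Lemma homoclinic_far U x : open_at0 U -> homoclinic X x ->
  cofinite_set [set g : G | forall u, U (lie (lact g x) u)].
Proof.
move=> [P PU] /homoclinicP xH; have [Q QP] := binary_uniform P (@lie_block K G A X).
apply: sub_cofinite_set (xH Q) => g gx u; apply: PU.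
by rewrite /= -(lie0l u); apply: QP.
Qed.

(** Since [homoclinic_far] is uniform in [u], it applies with [u] the translate of [y], even if [y]
    is not homoclinic. *)
Lemma homoclinic_lie x y : homoclinic X x -> homoclinic X (lie x y).
Proof.
move=> xH; apply/homoclinicP => P.
have Po : open_at0 [set z : L | lagree P z 0] by exists P.
apply: sub_cofinite_set (homoclinic_far Po xH) => g gx /=.
by rewrite act_lie; exact: gx.
Qed.

(** The cell of [lie x u] at [h] is the cell at 1 of the bracket of the translates by [h^-1].
    Outside a finite set of [h] independent of [u], it is that of 0. *)
Lemma finite_range_lie x : homoclinic X x -> finite_set (range (lie x)).
Proof.
move=> xH; pose U := [set z : L | lagree [:: 1%g] z 0].
have Uo : open_at0 U by exists [:: 1%g].
have /finite_seqP[R RE] := homoclinic_far Uo xH.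
have out u h : h^-1%g \notin R -> val (lie x u) h = val (0 : L) h.
  move=> hR.
  have E (z : L) : val z h = val (lact h^-1%g z) 1%g := esym (val1_act h z).
  rewrite (E (lie x u)) (E 0) act_lie act0.
  suff : forall v, U (lie (lact h^-1%g x) v) by move/(_ _ 1%g (mem_head _ _)).
  apply: contrapT => nU; move/negP: hR; apply.
  by have : [set` R] h^-1%g by rewrite -RE.
(* Restriction to the exceptional cells is injective on the range. *)
pose r (z : L) := map_tuple (fun g => val z g^-1%g) (in_tuple R).
have rinj : {in range (lie x) &, injective r}.
  move=> _ _ /set_mem[u _ <-] /set_mem[v _ <-] ruv; apply/val_inj/funext => h.
  have [hR|hR] := boolP (h^-1%g \in R); last by rewrite !out.
  have /(congr1 val)/eq_in_map/(_ _ hR) := ruv; by rewrite invgK.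
by rewrite -(eq_finite_set (inj_card_eq rinj)); exact: finite_finset.
Qed.

Section Orbit.
Variable Y : set L.
Hypotheses (Yfin : finite_set Y) (D_gen : homoclinic X = orbit_generated Y).
Let orbits := [set z : L | exists g, exists2 y, Y y & z = act g y].

Lemma orbit_homoclinic : orbits `<=` homoclinic X.
Proof. by rewrite D_gen; exact: sub_gen_smallest. Qed.

Lemma generator_homoclinic : Y `<=` homoclinic X.
Proof.
move=> y Yy; apply: orbit_homoclinic; exists 1%g; exists y => //.
by apply: val_inj; apply/funext => h; rewrite val_act invg1 mul1g.
Qed.

(** Each of the finitely many generators has finitely many exceptional translates. *)
Lemma orbit_far U : open_at0 U ->
  exists M : seq L, forall x, orbits x -> x \notin M -> forall u, U (lie x u).
Proof.
move=> Uo.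
pose bad := \bigcup_(y in Y) ((fun g => lact g y) @`
  ~` [set g : G | forall u, U (lie (lact g y) u)]).
have /finite_seqP[M ME] : finite_set bad.
  apply: bigcup_finite => // y /generator_homoclinic yH.
  by apply: finite_image; exact: homoclinic_far.
exists M => _ [g [y Yy ->]] gyM u; apply: contrapT => nU.
move/negP: gyM; apply; suff : [set` M] (lact g y) by [].
by rewrite -ME; exists y => //; exists g => // /(_ u).
Qed.

Lemma homoclinic_ind (P : set L) : P 0 -> (forall x y, P x -> P y -> P (x - y)) ->
  orbits `<=` P -> homoclinic X `<=` P.
Proof.
move=> P0 PB SP; rewrite D_gen; apply: smallest_sub => //; split=> [|x y].
  exact/mem_set.
by rewrite !in_setE; exact: PB.
Qed.

(** A point of T_n is in T_(n+1) when all its brackets with homoclinic points are in T_n. As T_n is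
    a subspace, generators suffice; as T_n is open, all but finitely many of them satisfy this for
    every [u], and the rest impose finitely many open conditions. *)
Lemma word_core_open U n : linear_subspace U -> open_at0 U ->
  open_at0 (word_core (homoclinic X) U n).
Proof.
move=> subU Uo; elim: n => [|n IHn]; first by apply: open_at0W Uo => u Uu [].
have subn := word_core_subspace (homoclinic X) subU n.
have [M MP] := orbit_far IHn.
have Mo := open_at0_all M (fun m => open_at0_lie m IHn).
apply: open_at0W (open_at0I IHn Mo) => u [un uM].
have {uM} un1 : homoclinic X `<=` [set x | word_core (homoclinic X) U n (lie x u)].
  apply: homoclinic_ind => [|x y xu yu|x Sx] /=.
  - by rewrite lie0l; case: subn.
  - by rewrite lieBl; exact: (linear_subspaceB subn xu yu).
  - by have [/uM|/MP] := boolP (x \in M); last exact.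
(* The last letter of a word is the one applied first. *)
case/lastP=> [|s x]; first by move=> _ _; exact: (un [::]).
rewrite size_rcons ltnS -cats1 ad_word_cat => sn.
move=> /letters_in_cat[Ds /letters_in_cons[Dx _]]; exact: (un1 _ Dx).
Qed.

Lemma open_ideal_exists U : linear_subspace U -> open_at0 U ->
  (forall x P, exists2 a, homoclinic X a & lagree P x a) ->
  exists I : set L, [/\ linear_subspace I, open_at0 I, I `<=` U &
    forall x u, I u -> I (lie x u)].
Proof.
move=> subU Uo dense; have [M MP] := orbit_far Uo.
(* [d] bounds the exponents [j] found for the finitely many members of [M]. *)
have [d dP] : exists d, forall x, orbits x -> x \in M ->
    exists i j, [/\ (i < j)%N, (j <= d)%N & iter j (lie x) =1 iter i (lie x)].
  elim: (M) => [|m M' [d dP]]; first by exists 0%N.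
  have [Sm|nSm] := pselect (orbits m); last first.
    exists d => x Sx; rewrite inE => /predU1P[xm|]; last exact: dP.
    by rewrite xm in Sx.
  have [i [j [ij ji]]] := iter_finite_range (finite_range_lie (orbit_homoclinic Sm)).
  exists (maxn d j) => x Sx; rewrite inE.
  case/predU1P=> [->|/(dP x Sx)[i' [j' [ij' jd' e]]]].
    by exists i, j; rewrite leq_maxr.
  by exists i', j'; rewrite leq_max jd'.
pose n := (size M * d)%N; pose I := word_core (homoclinic X) U n.
have subI : linear_subspace I by exact: word_core_subspace.
have Io : open_at0 I by exact: word_core_open.
(* As [u] lies in T_(n+1), a word of length at most [n] may be extended by the letter [a]. *)
have lieI a u : homoclinic X a -> I u -> I (lie a u).
  move=> aH /(word_core_stable subU (fun x y xH _ => homoclinic_lie y xH)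
    orbit_homoclinic homoclinic_ind MP dP (leqnn _)) un1 s sn Ds.
  have := un1 (s ++ [:: a]); rewrite ad_word_cat size_cat addn1 ltnS; apply=> //.
  by apply/letters_in_cat; split=> // b; rewrite inE => /eqP->.
exists I; split=> // [u uI|x u Iu]; first exact: (uI [::]).
(* Density gives a homoclinic [a] so close to [x] that [lie x u] and [lie a u] lie in the same coset
   of [I]. *)
have [Q QI] := open_at0_cosets Io.
have [R RQ] := binary_uniform Q (@lie_block K G A X).
have [a aH xa] := dense x R.
rewrite -[lie x u](subrK (lie a u)).
apply: (linear_subspaceD subI); last exact: lieI.
by apply: QI; apply: RQ.
Qed.
End Orbit.
End Ideal.

(** * Recoding by an open ideal *)

Section Transport.
Variables (K : fieldType) (L : lieAlgType K) (T : choiceType).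
Variables (f : T -> L) (g : L -> T).

(** The alias records the bijection in the type, so that instances depending on it can be
    attached. *)
Definition transport (fK : cancel f g) (gK : cancel g f) : Type := T.

Variables (fK : cancel f g) (gK : cancel g f).
Local Notation W := (transport fK gK).
HB.instance Definition _ := Choice.on W.

Let zero : W := g 0.
Let opp (x : W) : W := g (- f x).
Let add (x y : W) : W := g (f x + f y).
Let scale (a : K) (x : W) : W := g (a *: f x).
Let bracket (x y : W) : W := g (lie (f x) (f y)).

Let addA : associative add.
Proof. by move=> x y z; rewrite /add !gK addrA. Qed.
Let addC : commutative add.
Proof. by move=> x y; rewrite /add addrC. Qed.
Let add0 : left_id zero add.
Proof. by move=> x; rewrite /add gK add0r fK. Qed.
Let addN : left_inverse zero opp add.
Proof. by move=> x; rewrite /add gK addNr. Qed.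
HB.instance Definition _ := GRing.isZmodule.Build W addA addC add0 addN.

Let scaleA a b (x : W) : scale a (scale b x) = scale (a * b) x.
Proof. by rewrite /scale gK scalerA. Qed.
Let scale1 : left_id 1 scale.
Proof. by move=> x; rewrite /scale scale1r fK. Qed.
Let scaleDr : right_distributive scale +%R.
Proof. by move=> a x y; rewrite /scale /GRing.add /= /add !gK scalerDr. Qed.
Let scaleDl (x : W) : {morph scale^~ x : a b / a + b}.
Proof. by move=> a b; rewrite /scale /GRing.add /= /add !gK scalerDl. Qed.
HB.instance Definition _ :=
  GRing.Zmodule_isLmodule.Build K W scaleA scale1 scaleDr scaleDl.

Let bracket_linearl (y : W) : linear (bracket^~ y).
Proof.
move=> a x z; apply: (can_inj fK).
by rewrite /bracket /GRing.add /GRing.scale /= /add /scale !gK lieDl lieZl.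
Qed.
Let bracket_linearr (x : W) : linear (bracket x).
Proof.
move=> a y z; apply: (can_inj fK).
by rewrite /bracket /GRing.add /GRing.scale /= /add /scale !gK linearP.
Qed.
Let bracketxx (x : W) : bracket x x = 0.
Proof. by rewrite /bracket liexx. Qed.
Let bracket_jacobi (x y z : W) :
  bracket x (bracket y z) + bracket y (bracket z x) + bracket z (bracket x y) = 0.
Proof. by rewrite /bracket /GRing.add /= /add !gK lie_jacobi. Qed.
HB.instance Definition _ := Lmodule_isLieAlgebra.Build K W
  bracket_linearl bracket_linearr bracketxx bracket_jacobi.

Definition transport_class : LieAlgebra K T := LieAlgebra.class (W : lieAlgType K).
End Transport.

Lemma cellwise_block_code (G : groupType) (A B : finType)
    (X : subshift G A) (Y : subshift G B) (f : X -> Y) :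
  has_neighborhood f [set 1%g] -> block_code f.
Proof.
move=> [F fF]; split.
  apply: continuous_cylinders => P; exists P => x y xy p pP; rewrite !fF.
  congr F; apply/funext => -[n /set_mem /= ->].
  by rewrite /shift invgK mulg1; exact: xy.
move=> g x; apply: val_inj; apply/funext => h.
rewrite val_act !fF; congr F; apply/funext => n.
by rewrite /shift /= /shift !invgK mulgA.
Qed.

Lemma cellwise_nary_block_code (G : groupType) (A : finType)
    (X : subshift G A) n (f : ('I_n -> X) -> X) :
  nary_has_neighborhood f [set 1%g] -> nary_block_code f.
Proof. exact: cellwise_block_code. Qed.

(** * The subshift of cosets *)

Section Quotient.
Variables (K : finFieldType) (G : groupType) (A : finType) (X : lieSubshift K G A).
Local Notation L := (points X).
Local Notation lact g x := (@act G A X g (x : L) : L).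
Variable I : set L.
Hypothesis subI : linear_subspace I.
Hypothesis cellI : forall x, I x -> val x 1%g = val (0 : L) 1%g.
Hypothesis idealI : forall x u : L, I u -> I (lie x u).
Variable Q : seq G.
Hypothesis cosetI : forall x y : L, lagree Q x y -> I (x - y).

(** The choice is made from the coset as a set, so points of one coset share their representative.
    The default 0 is never reached, since [x] lies in its own coset. *)
Definition coset_rep (x : L) : L := xget 0 [set y | I (y - x)].

Lemma coset_repP x : I (coset_rep x - x).
Proof.
suff : [set y | I (y - x)] (coset_rep x) by [].
by apply: (@xgetPex _ 0); exists x; rewrite /= subrr; case: subI.
Qed.

(* Restricting a fixed representative of each coset to Q makes A^|Q| an alphabet
   for the quotient X / I. *)
Definition code (x : L) : (size Q).-tuple A :=
  map_tuple (val (coset_rep x)) (in_tuple Q).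

Lemma codeP x y : code x = code y <-> I (x - y).
Proof.
split=> [xy|xy].
  have rI : I (coset_rep x - coset_rep y).
    by apply: cosetI => q qQ; have /(congr1 val)/eq_in_map/(_ _ qQ) := xy.
  have -> : x - y = (coset_rep x - coset_rep y) -
                    (coset_rep x - x) + (coset_rep y - y).
    by rewrite opprB [_ + (x - _)]addrC !subrKA.
  apply: (linear_subspaceD subI); last exact: coset_repP.
  by apply: (linear_subspaceB subI) => //; exact: coset_repP.
rewrite /code /coset_rep.
rewrite (_ : [set z | I (z - x)] = [set z | I (z - y)]) //.
apply/seteqP; split=> z /= zI.
  by rewrite -(subrKA x); exact: (linear_subspaceD subI).
by rewrite -(subrKA y) -(opprB x y); exact: (linear_subspaceB subI).
Qed.

Definition encode_fun (x : L) : fullShift G ((size Q).-tuple A) :=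
  fun g => code (lact g^-1%g x).

Lemma encode_fun_agree P x y : lagree [seq p * q | p <- P, q <- Q]%g x y ->
  agree P (encode_fun x) (encode_fun y).
Proof.
move=> xy p pP; apply/codeP; apply: cosetI => q qQ.
rewrite /= /shift invgK; apply: xy; exact: allpairs_f.
Qed.

Lemma encode_fun_continuous : continuous (encode_fun : X -> fullShift G _).
Proof.
move=> x U /nbhs_cylinder[P PU]; apply/subshift_nbhs.
by exists [seq p * q | p <- P, q <- Q]%g => y xy; apply: PU; exact: encode_fun_agree.
Qed.

(** Equal codes put every translate of [x - y] in [I], where the cell at 1 is that of 0. *)
Lemma encode_fun_inj : injective encode_fun.
Proof.
move=> x y xy; apply: eq_cell => g; apply: cellI; rewrite actB; apply/codeP.
by have /(congr1 (fun z => z g^-1%g)) := xy; rewrite /encode_fun invgK.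
Qed.

Lemma encode_fun_act g x : encode_fun (lact g x) = shift g (encode_fun x).
Proof. by apply/funext => h; rewrite /encode_fun /shift -actM invgM invgK. Qed.

(** A continuous image of a compact space in a Hausdorff space is closed. *)
Lemma encode_closed : closed (range encode_fun).
Proof.
apply: (compact_closed (@fullShift_hausdorff G _)).
apply: continuous_compact; last exact: (@subshift_compact G A X).
by apply: continuous_subspaceT; exact: encode_fun_continuous.
Qed.

Lemma encode_invariant g z : range encode_fun z -> range encode_fun (shift g z).
Proof. by move=> [x _ <-]; exists (lact g x) => //; exact: encode_fun_act. Qed.

Definition quotient_subshift : subshift G ((size Q).-tuple A) :=
  Subshift encode_closed encode_invariant.
Local Notation Y := quotient_subshift.

Lemma encode_subproof x : encode_fun x \in (Y : set _).
Proof. by apply/mem_set; exists x. Qed.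

Definition encode (x : L) : Y := exist _ (encode_fun x) (encode_subproof x).

Definition decode (y : Y) : L := s2val (cid2 (set_valP y)).

Lemma decodeK : cancel decode encode.
Proof. by move=> y; apply: val_inj; rewrite /= /decode; case: cid2. Qed.

Lemma encodeK : cancel encode decode.
Proof. by move=> x; apply/encode_fun_inj/(congr1 val (decodeK (encode x))). Qed.

(** Equivariance moves the cell [g] to 1, and there compatibility with cosets makes the result
    depend only on the codes of the arguments. *)
Lemma encode_cellwise n (op : ('I_n -> L) -> L) :
  (forall g v, op (fun i => lact g (v i)) = lact g (op v)) ->
  (forall v w, (forall i, I (v i - w i)) -> I (op v - op w)) ->
  @nary_has_neighborhood G _ Y n
    (fun v => encode (op (fun i => decode (v i)))) [set 1%g].
Proof.
move=> op_act opI; pose dec b : L := xget 0 [set x | code x = b].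
have decP x : I (x - dec (code x)).
  apply/codeP; apply/esym; suff : [set y | code y = code x] (dec (code x)) by [].
  by apply: (@xgetPex _ 0); exists x.
have mem1 : (1%g : G) \in [set 1%g] by exact/mem_set.
(* The local function picks a point with each given code, applies [op] and encodes the result. The
   default 0 in [dec] serves only letters that are not codes. *)
exists (fun c : _ -> {ffun 'I_n -> (size Q).-tuple A} =>
  code (op (fun i => dec (c (exist _ 1%g mem1) i)))) => p g.
rewrite /= /encode_fun -op_act; apply/codeP; apply: opI => i.
rewrite /shift invgK mulg1.
have -> : val p g i = code (lact g^-1%g (decode (tracks p i))); last exact: decP.
by have /(congr1 (fun y : Y => val y g)) := decodeK (tracks p i).
Qed.

Definition quotient_lieOn : lieOnSubshift K G ((size Q).-tuple A) :=
  @LieOnSubshift K G _ Y (@transport_class K L Y decode encode decodeK encodeK).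

Lemma quotient_cellwise :
  lie_operations (fun n (f : (_ -> points quotient_lieOn) -> _) =>
    @nary_has_neighborhood G _ quotient_lieOn n f [set 1%g]).
Proof.
split=> [|a||].
- apply: (@encode_cellwise 0 (fun=> 0)) => [g v|v w _]; first by rewrite act0.
  by rewrite subrr; case: subI.
- apply: (@encode_cellwise 1 (fun v => a *: v ord0)) => [g v|v w vw].
    by rewrite actZ.
  by rewrite -scalerBr -[X in I X]addr0; case: subI => I0; apply.
- apply: (@encode_cellwise 2 (fun v => v ord0 + v ord_max)) => [g v|v w vw].
    by rewrite actD.
  by rewrite opprD addrACA; apply: (linear_subspaceD subI).
- apply: (@encode_cellwise 2 (fun v => lie (v ord0) (v ord_max))) => [g v|v w vw].
    by rewrite act_lie.
  (* The difference of brackets splits as [v0 - w0, v1] + [w0, v1 - w1]; the first term needs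
     anticommutativity, as [idealI] concerns the right argument. *)
  rewrite -(subrKA (lie (w ord0) (v ord_max))) -lieBl -raddfB.
  apply: (linear_subspaceD subI); last exact: idealI.
  by rewrite lieC -sub0r; apply: (linear_subspaceB subI); [case: subI|exact: idealI].
Qed.

Lemma quotient_block_codes :
  lie_operations (fun n (f : (_ -> points quotient_lieOn) -> _) =>
    @nary_block_code G _ quotient_lieOn n f).
Proof.
have [c0 cZ cD cl] := quotient_cellwise; split=> [|a||].
- exact: cellwise_nary_block_code c0.
- exact: cellwise_nary_block_code (cZ a).
- exact: cellwise_nary_block_code cD.
- exact: cellwise_nary_block_code cl.
Qed.

Definition quotient_lieSubshift := LieSubshift quotient_block_codes.

Lemma ideal_cellwiseable : cellwiseable X.
Proof.
exists _, quotient_lieSubshift; split; first exact: quotient_cellwise.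
exists encode; split=> [|a x y|x y].
- split; last by exists decode; [exact: encodeK|exact: decodeK].
  split; last by move=> g x; apply: val_inj; exact: encode_fun_act.
  apply: continuous_cylinders => P.
  by exists [seq p * q | p <- P, q <- Q]%g => x y; exact: encode_fun_agree.
- by rewrite /GRing.add /GRing.scale /= !encodeK.
- by rewrite /lie /= !encodeK.
Qed.
End Quotient.

Theorem theorem7 (K : finFieldType) (G : groupType) (A : finType)
    (X : lieSubshift K G A) :
  finitely_generated G ->
  (X : set (fullShift G A)) = closure [set val x | x in homoclinic X] ->
  finitely_orbit_generated (homoclinic X) ->
  cellwiseable X.
Proof.
move=> _ Xcl [Y Yfin YE].
have dense (x : points X) P : exists2 a, homoclinic X a & lagree P x a.
  have : closure [set val a | a in homoclinic X] (val x).
    by rewrite -Xcl; exact: set_valP.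
  move=> /(_ [set y | agree P (val x) y])[|_ [[a aH <-] xa]]; last by exists a.
  by apply/nbhs_cylinder; exists P.
have [I [subI Io IU idealI]] :=
  open_ideal_exists Yfin YE (@core_subspaceP K G A X)
    (@core_subspace_open K G A X) dense.
have [Q QI] := open_at0_cosets Io.
by apply: (ideal_cellwiseable subI _ idealI QI) => x /IU; exact: core_subspace_cell.
Qed.
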